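(* Let $\mathcal{D}=(\mathcal{P},\mathcal{B})$ be a biplane with parameters $(v,k,2)$ and $k\geq 4$, and let $G\leq\mathrm{Aut}(\mathcal{D})$ act primitively on the point set $\mathcal{P}$. Then $G$ (as a primitive permutation group on $\mathcal{P}$) cannot be of type PA, HC, or CD.
   Context: A biplane with parameters $(v,k,2)$ is a finite incidence structure $\mathcal{D}=(\mathcal{P},\mathcal{B})$ consisting of a set $\mathcal{P}$ of $v$ points and a set $\mathcal{B}$ of $v$ blocks, each of which is a $k$-subset of $\mathcal{P}$, such that every pair of distinct points lies in exactly $2$ blocks. $\mathrm{Aut}(\mathcal{D})$ is the group of permutations of $\mathcal{P}$ leaving $\mathcal{B}$ invariant. The types are those of the O'Nan–Scott Theorem for finite primitive permutation groups. Let $G$ be primitive on $\Omega$, let $\alpha\in\Omega$, and let $T$ denote a nonabelian simple group. - Type HC (holomorph compound): $G$ has two minimal normal subgroups, each isomorphic to $T^m$ with $m\geq 2$ and each regular on $\Omega$. - Type CD (compound diagonal): the unique minimal normal subgroup $N$ of $G$ is isomorphic to $T^m$ and, for some $\ell\mid m$ with $m\geq 2\ell\geq 4$, $N_\alpha\cong T^\ell$ is a direct product of $\ell$ strips, each a (full) diagonal subgroup of a subproduct $T^{m/\ell}$ of the simple direct factors of $N$ (the support set of the strip being the corresponding set of $m/\ell$ simple factors); the support sets of the strips form a system of imprimitivity for the $G$-action on the set of $m$ simple direct factors of $N$. - Type PA (product action): the unique minimal normal subgroup $N$ of $G$ is isomorphic to $T^m$ with $m\geq 2$, and $N_\alpha\cong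 R^m$ for some proper nontrivial subgroup $R$ of $T$. *)

(* Defs.v *)
From mathcomp Require Import all_boot all_fingroup all_solvable.
Set Implicit Arguments.
Unset Strict Implicit.
Unset Printing Implicit Defensive.
Local Open Scope group_scope.

Definition biplane (P : finType) (B : {set {set P}}) (v k : nat) : Prop :=
  [/\ #|P| = v,
      #|B| = v,
      forall b : {set P}, b \in B -> #|b| = k
    & forall x y : P, x != y ->
        #|[set b in B | (x \in b) && (y \in b)]| = 2].

(* ['P^*] lets a permutation [g] act on a set of points [b] by [b |-> g @: b],
   so this is the setwise stabiliser of the block set. *)
Definition autD (P : finType) (B : {set {set P}}) : {set {perm P}} :=
  'N(B | 'P^*).

Section Groups.

Variables (aT : finGroupType).

Definition direct_power (T : {group aT}) (m : nat) :
  {set {dffun forall i : 'I_m, aT}} := setXn (fun _ : 'I_m => T : {set aT}).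

Definition nonabelian_simple (T : {group aT}) : bool :=
  simple T && ~~ abelian T.

(* [minnormal N G] only asks that [G] normalise [N]; containment in [G] has to
   be added. *)
Definition minimal_normals (G : {group aT}) : {set {group aT}} :=
  [set N : {group aT} | minnormal N G && (N \subset G)].

Definition simple_factors (N : {group aT}) : {set {group aT}} :=
  [set S : {group aT} | simple S && [exists K : {group aT}, S \x K == N]].

End Groups.

(* [D] is [{prod_(S in A) phi_S t | t in T}] for isomorphisms [phi_S : T -> S],
   where the groups in [A] are meant to be simple direct factors of a common
   group; they then commute, so the order of the product is immaterial. *)
Definition full_diagonal (aT gT : finGroupType) (T : {group aT})
    (A : {set {group gT}}) (D : {group gT}) : Prop :=
  exists phi : {group gT} -> {morphism T >-> gT},
    (forall S : {group gT}, S \in A -> isom T S (phi S)) /\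
    D :=: [set \prod_(S in A) phi S t | t in T].

Section PrimitiveTypes.

Variables (Omega : finType) (G : {group {perm Omega}}).

Definition regular_on (N : {group {perm Omega}}) : Prop :=
  [transitive N, on [set: Omega] | 'P] /\
  forall omega : Omega, 'C_N[omega | 'P] = 1.

Definition type_HC : Prop :=
  exists (aT : finGroupType) (T : {group aT}) (m : nat)
         (N1 N2 : {group {perm Omega}}),
    [/\ nonabelian_simple T, 2 <= m,
        N1 != N2, minimal_normals G = [set N1; N2]
      & forall N : {group {perm Omega}}, N \in minimal_normals G ->
          N \isog direct_power T m /\ regular_on N].

(* [Sigma] is the set of supports, and [strip A] is the strip with support
   [A]. *)
Definition type_CD (alpha : Omega) : Prop :=
  exists (aT : finGroupType) (T : {group aT}) (m l : nat)
         (N : {group {perm Omega}}),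
    [/\ nonabelian_simple T,
        minimal_normals G = [set N],
        N \isog direct_power T m,
        [&& l %| m, 2 * l <= m & 4 <= 2 * l]
      & 'C_N[alpha | 'P] \isog direct_power T l /\
        exists (Sigma : {set {set {group {perm Omega}}}})
               (strip : {set {group {perm Omega}}} -> {group {perm Omega}}),
          [/\ #|Sigma| = l,
              imprimitivity_system G (simple_factors N) 'JG Sigma,
              forall A, A \in Sigma ->
                #|A| = m %/ l /\ full_diagonal T A (strip A)
            & \big[dprod/1]_(A in Sigma) strip A = 'C_N[alpha | 'P]]].

Definition type_PA (alpha : Omega) : Prop :=
  exists (aT : finGroupType) (T : {group aT}) (m : nat)
         (N : {group {perm Omega}}),
    [/\ nonabelian_simple T, 2 <= m,
        minimal_normals G = [set N],
        N \isog direct_power T m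
      & exists R : {group aT},
          [/\ R \proper T, R :!=: 1
            & 'C_N[alpha | 'P] \isog direct_power R m]].

End PrimitiveTypes.

(* Main.v *)
From Stdlib Require Import ZArith Lia.
From mathcomp Require Import all_boot all_fingroup all_solvable all_character.
From mathcomp Require Import zify.
Require Import Defs.
Local Open Scope group_scope.
Set Implicit Arguments.
Unset Strict Implicit.
Unset Printing Implicit Defensive.

(** A biplane does not tolerate automorphisms with many fixed points: for
    [6 < k], a nontrivial automorphism fixes fewer than [2 * sqrt v] points
    ([biplane_fix_bound]).  In a primitive group of type PA, HC or CD the
    points look like a cartesian power of exponent at least 2, and an element
    living in a single coordinate fixes so many points that this bound fails.

    The fixed point bound is the expander mixing inequality between the set
    [F] of fixed points and the set [F'] of fixed blocks.  A moved block
    meets [F] inside the intersection of two distinct blocks, hence in at most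
    2 points; so nearly all the [k * #|F|] flags on [F] lie on blocks of [F'],
    and comparing with the second moment of the block sizes [#|b :&: F|] gives
    [(f - k) ^ 2 <= k - 2] for [f = #|F|] when [#|F'| <= #|F|] and [f] is not
    small.  Since biplanes are self-dual as a class, the larger of [#|F|] and
    [#|F'|] may be taken as [f].

    The group side is [many_fixed_points].  Suppose that commuting groups [L]
    and [K] generate a transitive group and that [K] contains a conjugate of
    [L] under the stabiliser of [alpha].  If [d] in [L] fixes two points of
    the [L]-orbit of [alpha] lying in different [K]-orbits, it fixes both of
    these [K]-orbits pointwise, whereas the number of points is at most the
    square of their common length; so [d] fixes at least [2 * sqrt v] points.

    For type PA, [L] is a simple direct factor of the socle [N] and [K] its
    centraliser.  As [N_alpha] is isomorphic to [R ^ m] with [R] smaller than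
    [T], it cannot project onto [L], and then maximality of [G_alpha] forces
    the part of [N_alpha] in [L] to be the whole projection
    ([stabilizer_splits]).  By the theorem of Frobenius, a proper nontrivial
    subgroup of a simple group meets one of its conjugates nontrivially
    ([simple_not_TI]), and this provides [d].  For type CD, [L] is the product
    of the factors supporting one strip, [d] is an element
    [(t, t, .., t)] of that strip, and the second fixed point is the image of
    [alpha] under [(t, 1, .., 1)], which commutes with [d].  For type HC,
    a group with two regular minimal normal subgroups contains for every [t]
    in the first one an element that fixes [alpha] and acts on the points as
    conjugation by [t]; it fixes as many points as [t] has centralising
    elements, and these are at least [2 * sqrt v] if [t] lies in one factor.

    Finally [6 < k] follows from [16 < v].  For HC and CD this is clear from
    the order of [T]; for PA it amounts to [4 < #|T : R|], which follows from
    Burnside's theorem on groups of order [p ^ a * q ^ b]. *)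

(** * Arithmetic of the fixed point bound *)

Section Arithmetic.
Local Open Scope Z_scope.

(** Here [f] and [f'] count the fixed points and the fixed blocks, [w] the moved
    blocks; [S] and [U] are the sums of [#|b :&: F|] over fixed and over moved
    blocks, and [X1], [X2] the corresponding sums of squares.  For
    [k = 6] the conclusion fails: take [f = f' = w = 8], [v = 16], [S = 32],
    [U = 16], [X1 = 128] and [X2 = 32]. *)
Lemma mixing_arithZ (k v f f' w S U X1 X2 : Z) :
  7 <= k -> 2 * v + k = k * k + 2 -> v = f' + w -> 0 < w ->
  0 <= f' -> f' <= f -> f < v ->
  S + U = k * f -> 0 <= U -> U <= 2 * w -> S * S <= f' * X1 -> U * U <= w * X2 ->
  X1 + X2 = f * (k + 2 * f - 2) -> f * f < 4 * v.
Proof.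
move=> k7 vk vE w0 f'0 lef'f ltfv SU U0 leU CS CU X12.
case: (Z.lt_ge_cases (f * f) (4 * v)) => // f2; exfalso.
have kf : 2 * v < k * f by nia.
have k2 : 7 * k <= k * k by apply: Z.mul_le_mono_nonneg_r; lia.
(* Weighted sum of the two Cauchy-Schwarz inequalities, then monotonicity in
   [U] on the range [U <= 2 * w], where [U] is below its balanced value. *)
have h1 : w * (S * S) + f' * (U * U) <= w * (f' * (f * (k + 2 * f - 2))).
  rewrite -X12; have := Z.mul_le_mono_nonneg_l _ _ w _ CS.
  have := Z.mul_le_mono_nonneg_l _ _ _ f'0 CU; lia.
have h2 : w * ((k * f - 2 * w) * (k * f - 2 * w) + 4 * f' * w)
    <= w * (S * S) + f' * (U * U).
  have -> : S = k * f - U by lia.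
  suff : 0 <= 2 * w * (2 * w - U) * (k * f - 2 * v) + v * ((2 * w - U) * (2 * w - U)).
    by rewrite vE; lia.
  by apply: Z.add_nonneg_nonneg; repeat (apply: Z.mul_nonneg_nonneg); lia.
have h3 : (k * f - 2 * w) * (k * f - 2 * w) + 4 * f' * w <= f' * (f * (k + 2 * f - 2)).
  by apply: (Zmult_le_reg_r _ _ w); lia.
(* [y = (f - k) ^ 2 - (k - 2)], and [(k f - 2 v) ^ 2 - (k - 2) f ^ 2 = 2 v y];
   so [y > 0] together with [f' <= f < v] contradicts [h3]. *)
pose y := f * f - 2 * k * f + 2 * v.
have h4 : (k * f - 2 * v) * (k * f - 2 * v) <= f' * (f * (k - 2) + 2 * y).
  have := h3; have -> : w = v - f' by lia.
  by rewrite /y; lia.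
have y0 : 0 < y.
  case: (Z.lt_ge_cases 0 y) => // y0; exfalso.
  have e : (f - k) * (f - k) <= k - 2 by rewrite /y in y0; lia.
  (* [e3] and [e4] leave [(k - 6) (k ^ 3 - 4 k ^ 2 + 5 k - 6) <= 0]. *)
  have e2 : k * k - 3 * k + 6 <= 2 * k * (f - k) by lia.
  have e3 : (k * k - 3 * k + 6) * (k * k - 3 * k + 6)
      <= (2 * k * (f - k)) * (2 * k * (f - k)).
    by apply: Z.mul_le_mono_nonneg; lia.
  have e4 : (2 * k * (f - k)) * (2 * k * (f - k)) <= 4 * k * k * (k - 2).
    have := Z.mul_le_mono_nonneg_l _ _ (4 * k * k) _ e; lia.
  have e5 : 0 < (k - 6) * (k * k * (k - 4) + 5 * k - 6).
    apply: Z.mul_pos_pos; first lia.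
    have := Z.mul_le_mono_nonneg_l _ _ (k - 4) _ k2; lia.
  lia.
have h5 : (k * f - 2 * v) * (k * f - 2 * v) <= f * (f * (k - 2) + 2 * y).
  apply: Z.le_trans h4 _; apply: Z.mul_le_mono_nonneg_r => //.
  apply: Z.add_nonneg_nonneg; [apply: Z.mul_nonneg_nonneg | ]; lia.
have h6 : (k * f - 2 * v) * (k * f - 2 * v) = (k - 2) * (f * f) + 2 * v * y.
  have -> : (k * f - 2 * v) * (k * f - 2 * v)
      = (k * k) * (f * f) - 4 * k * f * v + 4 * v * v by lia.
  have -> : k * k = 2 * v + k - 2 by lia.
  by rewrite /y; lia.
have := proj1 (Z.mul_lt_mono_pos_r y f v y0) ltfv; lia.
Qed.

End Arithmetic.

(** * Symmetric incidence structures with parameter 2 *)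

Section SquareDesign.
Local Open Scope nat_scope.

Lemma fixed_points_arith k v f f' w S U X1 X2 :
  6 < k -> 2 * v + k = k * k + 2 -> v = f' + w -> 0 < w -> f' <= f -> f < v ->
  S + U = k * f -> U <= 2 * w -> S ^ 2 <= f' * X1 -> U ^ 2 <= w * X2 ->
  X1 + X2 = f * (k + 2 * f.-1) -> f ^ 2 < 4 * v.
Proof.
move=> k_gt6 vk vE w_gt0 lef'f ltfv SU leU CS CU X12.
have {}X12 : X1 + X2 + 2 * f = f * (k + 2 * f).
  by rewrite X12; case: (f) => //=; lia.
have := @mixing_arithZ (Z.of_nat k) (Z.of_nat v) (Z.of_nat f) (Z.of_nat f')
  (Z.of_nat w) (Z.of_nat S) (Z.of_nat U) (Z.of_nat X1) (Z.of_nat X2).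
rewrite -!mulnn in CS CU *; lia.
Qed.

Lemma sqr_sum_leq_card (I : finType) (A : {set I}) (E : I -> nat) :
  (\sum_(i in A) E i) ^ 2 <= #|A| * \sum_(i in A) E i ^ 2.
Proof.
rewrite -(@leq_pmul2l 2) // -mulnn big_distrlr /= big_distrr /=.
have -> : 2 * (#|A| * \sum_(i in A) E i ^ 2)
    = \sum_(i in A) \sum_(j in A) (E i ^ 2 + E j ^ 2).
  under [RHS]eq_bigr do rewrite big_split /= sum_nat_const.
  by rewrite big_split /= -big_distrr /= sum_nat_const; lia.
apply: leq_sum => i _; rewrite big_distrr /=.
by apply: leq_sum => j _; rewrite nat_Cauchy.
Qed.

(** An incidence relation between two types, so that exchanging points and
    blocks is a mere transposition; incidence is a 0-1 valued summand. *)
Definition square_biplane (P Q : finType) (I : P -> Q -> bool) (v k : nat) :=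
  [/\ #|P| = v, #|Q| = v,
      forall x, \sum_b I x b = k, forall b, \sum_x I x b = k
    & (forall x y, x != y -> \sum_b (I x b && I y b) = 2) /\
      (forall b c, b != c -> \sum_x (I x b && I x c) = 2)].

Lemma square_biplane_tr (P Q : finType) (I : P -> Q -> bool) v k :
  @square_biplane P Q I v k -> square_biplane (fun b x => I x b) v k.
Proof. by case=> ? ? ? ? [? ?]; split. Qed.

(** Both sides count triples of two points of [F] and a block containing them,
    the two points being possibly equal. *)
Lemma sum_sqr_incidence (P Q : finType) (I : P -> Q -> bool) (F : {set P}) k :
  (forall x, \sum_b I x b = k) ->
  (forall x y, x != y -> \sum_b (I x b && I y b) = 2) ->
  \sum_b (\sum_(x in F) I x b) ^ 2 = #|F| * (k + 2 * #|F|.-1).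
Proof.
move=> Ik I2; have -> : \sum_b (\sum_(x in F) I x b) ^ 2
    = \sum_(x in F) \sum_(y in F) \sum_b I x b * I y b.
  under [RHS]eq_bigr do rewrite exchange_big /=.
  rewrite [RHS]exchange_big; apply: eq_bigr => b _.
  by rewrite -mulnn big_distrlr.
rewrite -sum_nat_const; apply: eq_bigr => x Fx.
rewrite (bigD1 x) //=; congr (_ + _).
  by rewrite -(Ik x); apply: eq_bigr => b _; case: (I x b).
rewrite (eq_bigr (fun=> 2)) => [|y /andP[_ yx]]; last first.
  by rewrite -(I2 x y) 1?eq_sym //; apply: eq_bigr => b _; rewrite mulnb.
rewrite sum_nat_const mulnC; congr (_ * _).
rewrite (cardsD1 x F) Fx add1n /= -sum1_card -[RHS]sum1_card.
by apply: eq_bigl => y; rewrite !inE andbC.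
Qed.

(** The second moment identity, applied to the set of all points. *)
Lemma square_biplane_param (P Q : finType) (I : P -> Q -> bool) v k :
  @square_biplane P Q I v k -> 0 < v -> 0 < k ->
  2 * v + k = k * k + 2.
Proof.
case=> oP oQ rI cI [pI _] v_gt0 k_gt0; have := @sum_sqr_incidence P Q I setT k rI pI.
rewrite cardsT oP (eq_bigr (fun=> k ^ 2)) => [|b _]; last first.
  by rewrite -(cI b) (eq_bigl _ _ (in_setT (T := P))).
rewrite sum_nat_const oQ => /eqP; rewrite eqn_pmul2l // => /eqP; nia.
Qed.

(** With as many blocks as points, constant block size and constant pair count
    already imply the dual conditions: the variance of the block intersection
    numbers vanishes. *)
Lemma square_biplaneI (P Q : finType) (I : P -> Q -> bool) v k :
  #|P| = v -> #|Q| = v -> 1 < k -> (forall b, \sum_x I x b = k) ->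
  (forall x y, x != y -> \sum_b (I x b && I y b) = 2) -> square_biplane I v k.
Proof.
move=> oP oQ k_gt1 cI pI; have k_gt0 := ltnW k_gt1.
have rI' x : (\sum_b I x b) * k.-1 = 2 * v.-1.
  rewrite -oP -(cardC1 x) -sum1_card big_distrr /=.
  transitivity (\sum_(y | y != x) \sum_b (I x b && I y b)); last first.
    by apply: eq_bigr => y yx; rewrite muln1 pI 1?eq_sym.
  rewrite exchange_big /= big_distrl /=; apply: eq_bigr => b _.
  have [Ixb|nIxb] := boolP (I x b); last by rewrite big1.
  by rewrite mul1n -(cI b) (bigD1 x) //= Ixb add1n.
have rI x : \sum_b I x b = k.
  have v_gt0 : 0 < v by rewrite -oP; apply/card_gt0P; exists x.
  have k1_gt0 : 0 < k.-1 by case: (k) k_gt1 => [|[]].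
  apply/eqP; rewrite -(eqn_pmul2l v_gt0); apply/eqP.
  transitivity (\sum_(y : P) \sum_b I y b).
    rewrite -{1}oP -sum_nat_const; apply: eq_bigr => y _; apply/eqP.
    by rewrite -(eqn_pmul2r k1_gt0) !rI'.
  by rewrite exchange_big (eq_bigr (fun=> k)) // sum_nat_const oQ.
split=> //; split=> // b c bc.
pose s d := \sum_x (I x b && I x d).
have sE d : s d = \sum_(x in [set x | I x b]) I x d.
  rewrite [RHS]big_mkcond; apply: eq_bigr => x _.
  by rewrite inE; case: (I x b).
have sb : s b = k by rewrite -(cI b); apply: eq_bigr => x _; rewrite andbb.
have ob : #|[set x | I x b]| = k.
  rewrite -sum1_card big_mkcond -(cI b); apply: eq_bigr => x _.
  by rewrite inE; case: (I x b).
have s1 : \sum_(d | d != b) s d + k = k * k.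
  have <- : \sum_d s d = \sum_(d | d != b) s d + k.
    by rewrite (bigD1 b) //= sb addnC.
  under eq_bigr do rewrite sE.
  by rewrite exchange_big (eq_bigr (fun=> k)) // sum_nat_const ob.
have s2 : \sum_(d | d != b) s d ^ 2 + k ^ 2 = k * (k + 2 * k.-1).
  have <- : \sum_d s d ^ 2 = \sum_(d | d != b) s d ^ 2 + k ^ 2.
    by rewrite (bigD1 b) //= sb addnC.
  under eq_bigr do rewrite sE.
  by rewrite (sum_sqr_incidence _ rI pI) ob.
have ov : \sum_(d : Q | d != b) 1 = v.-1 by rewrite sum1_card cardC1 oQ.
have v_gt0 : 0 < v by rewrite -oQ; apply/card_gt0P; exists b.
have vk : k * k.-1 = 2 * v.-1.
  by move: (v_gt0); rewrite -{1}oP => /card_gt0P[x _]; rewrite -(rI' x) rI.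
(* The intersection numbers [s d] with a given block [b] have mean 2 and their
   second moment leaves no variance. *)
have le4 d : d != b -> 2 * (s d * 2) <= s d ^ 2 + 2 ^ 2 ?= iff (s d == 2).
  by move=> _; apply: nat_Cauchy.
have [_ /esym] := leqif_sum le4.
have -> : (\sum_(d | d != b) 2 * (s d * 2)
    == \sum_(d | d != b) (s d ^ 2 + 2 ^ 2)).
  have -> : \sum_(d | d != b) 2 * (s d * 2) = 4 * \sum_(d | d != b) s d.
    by rewrite big_distrr; apply: eq_bigr => d _ /=; rewrite mulnCA mulnC.
  have ov4 : \sum_(d : Q | d != b) 2 ^ 2 = 4 * v.-1.
    by rewrite -ov big_distrr.
  rewrite [X in _ == X]big_split /= ov4; apply/eqP; nia.
by move=> /forall_inP/(_ c) /[!(eq_sym c)] /(_ bc)/eqP.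
Qed.

(** The case in which at least as many points as blocks are fixed; the other
    case is dual to it. *)
Lemma fixed_points_bound_aux (P Q : finType) (I : P -> Q -> bool) v k
  (p : P -> P) (q : Q -> Q) :
  @square_biplane P Q I v k -> 6 < k ->
  (forall x b, I (p x) (q b) = I x b) ->
  #|[set b | q b == b]| <= #|[set x | p x == x]| ->
  (exists x, p x != x) -> (exists b, q b != b) ->
  #|[set x | p x == x]| ^ 2 < 4 * v.
Proof.
move=> desI k_gt6 pqI; set F := [set x | p x == x].
set F' := [set b | q b == b] => leF'F [x0 mx0] [b0 mb0].
have [oP oQ rI cI [pI dI]] := desI.
have ltFv : #|F| < v.
  rewrite -oP -cardsT proper_card // properT; apply: contra mx0 => /eqP FT.
  by have:= in_setT x0; rewrite -FT inE.
have w_gt0 : 0 < #|~: F'| by apply/card_gt0P; exists b0; rewrite !inE.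
have defv : v = #|F'| + #|~: F'| by rewrite cardsC.
pose X b := \sum_(x in F) I x b.
have sumX : \sum_(b in F') X b + \sum_(b in ~: F') X b = k * #|F|.
  transitivity (\sum_b X b).
    rewrite [RHS](bigID (fun b => b \in F')) /=; congr (_ + _).
    by apply: eq_bigl => b; rewrite inE.
  rewrite /X exchange_big /= (eq_bigr (fun=> k)) ?sum_nat_const 1?mulnC //.
have sumX2 : \sum_(b in F') X b ^ 2 + \sum_(b in ~: F') X b ^ 2
    = #|F| * (k + 2 * #|F|.-1).
  rewrite -(@sum_sqr_incidence P Q I) // [RHS](bigID (fun b => b \in F')) /=.
  by congr (_ + _); apply: eq_bigl => b; rewrite inE.
(* A fixed point on a moved block [b] also lies on [q b]. *)
have U_le : \sum_(b in ~: F') X b <= 2 * #|~: F'|.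
  rewrite mulnC -sum_nat_const; apply: leq_sum => b; rewrite !inE => mb.
  rewrite -(dI b (q b)) 1?eq_sym // /X big_mkcond /=; apply: leq_sum => x _.
  rewrite inE; case: eqP => //= px.
  by have := pqI x b; rewrite px => ->; rewrite andbb.
have vk : 2 * v + k = k * k + 2.
  apply: square_biplane_param desI _ _; first exact: leq_ltn_trans ltFv.
  exact: leq_ltn_trans k_gt6.
exact: (fixed_points_arith k_gt6 vk defv w_gt0 leF'F ltFv sumX U_le
  (sqr_sum_leq_card _ _) (sqr_sum_leq_card _ _) sumX2).
Qed.

Lemma fixed_points_bound (P Q : finType) (I : P -> Q -> bool) v k
  (p : P -> P) (q : Q -> Q) :
  @square_biplane P Q I v k -> 6 < k ->
  (forall x b, I (p x) (q b) = I x b) -> (exists x, p x != x) ->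
  #|[set x | p x == x]| ^ 2 < 4 * v.
Proof.
move=> desI k_gt6 pqI [x mx]; have [oP oQ rI cI [pI dI]] := desI.
have exb : exists b, q b != b.
  have [/existsP // |] := boolP [exists b, q b != b].
  rewrite negb_exists => /forallP qid.
  have := pI _ _ mx; rewrite (eq_bigr (fun b => nat_of_bool (I x b))) ?rI.
    by move=> kE; rewrite kE in k_gt6.
  by move=> b _; have := pqI x b; rewrite (eqP (negbNE (qid b))) => ->; rewrite andbb.
have [leF'F | /ltnW leFF'] := leqP #|[set b | q b == b]| #|[set x | p x == x]|.
  by apply: fixed_points_bound_aux desI k_gt6 pqI leF'F _ exb; exists x.
apply: leq_ltn_trans (_ : #|[set b | q b == b]| ^ 2 < _).
  by rewrite leq_sqr.
apply: (@fixed_points_bound_aux _ _ _ v k q p (square_biplane_tr desI)) => //.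
by exists x.
Qed.

End SquareDesign.

(** * Automorphisms of biplanes *)

Lemma biplane_square (P : finType) (B : {set {set P}}) v k :
  biplane B v k -> 1 < k ->
  square_biplane (fun (x : P) (b : {b : {set P} | b \in B}) => x \in val b) v k.
Proof.
case=> oP oB kB pB k_gt1; apply: square_biplaneI => // [|b|x y xy].
- by rewrite card_sig -oB; apply: eq_card.
- by rewrite -(kB _ (valP b)) -sum1_card [RHS]big_mkcond.
rewrite -(big_sub (fun b => b \in B) (fun b : {set P} => (x \in b) && (y \in b) : nat)).
rewrite -(pB _ _ xy) -sum1_card -big_mkcondr; apply: eq_bigl => b.
by rewrite inE.
Qed.

Lemma autD_block (P : finType) (B : {set {set P}}) (g : {perm P}) (b : {set P}) :
  g \in autD B -> b \in B -> g @: b \in B.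
Proof.
by move=> /astabsP gB bB; have := gB b; rewrite bB.
Qed.

(** A weak form of the bound [k + sqrt (k - 2)], which is smaller than
    [2 * sqrt v] only from [k = 7] on and equal to it for [k = 6]. *)
Lemma biplane_fix_bound (P : finType) (B : {set {set P}}) v k (g : {perm P}) :
  biplane B v k -> 6 < k -> g \in autD B -> g != 1 ->
  #|'Fix_'P[g]| ^ 2 < 4 * v.
Proof.
move=> biB k_gt6 gB g_neq1.
have desI := biplane_square biB (leq_trans (isT : 1 < 7) k_gt6).
pose gb (b : {b : {set P} | b \in B}) : {b : {set P} | b \in B} :=
  exist _ (g @: val b) (autD_block gB (valP b)).
have gI (x : P) b : (g x \in val (gb b)) = (x \in val b).
  by rewrite /= mem_imset //; apply: perm_inj.
have mg : exists x, g x != x.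
  have [/existsP // |] := boolP [exists x, g x != x].
  rewrite negb_exists => /forallP gid; case/negP: g_neq1; apply/eqP/permP => x.
  by rewrite perm1; apply/eqP/negbNE.
rewrite (_ : 'Fix_'P[g] = [set x | g x == x]); last first.
  by apply/setP => x; rewrite inE; apply/afix1P/eqP.
exact: fixed_points_bound desI k_gt6 gI mg.
Qed.

(** For [k = 4, 5, 6] the number of points is 7, 11 and 16. *)
Lemma biplane_k_gt6 (P : finType) (B : {set {set P}}) v k :
  biplane B v k -> 4 <= k -> 16 < v -> 6 < k.
Proof.
move=> biB k_ge4 v_gt16.
have := square_biplane_param (biplane_square biB (leq_trans (isT : 1 < 4) k_ge4)).
by move=> /(_ (leq_ltn_trans (leq0n _) v_gt16) (leq_ltn_trans (leq0n _) k_ge4)); nia.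
Qed.

(** * Nonabelian simple groups *)

Lemma nonabelian_simple_primes (gT : finGroupType) (T : {group gT}) :
  nonabelian_simple T -> 2 < size (primes #|T|).
Proof.
case/andP=> simT; rewrite ltnNge; apply: contra => /Burnside_p_a_q_b solT.
by apply/cyclic_abelian/prime_cyclic/(simple_sol_prime solT simT).
Qed.

Lemma nonabelian_simple_card (gT : finGroupType) (T : {group gT}) :
  nonabelian_simple T -> 4 < #|T|.
Proof.
move/nonabelian_simple_primes; apply: contraTT; rewrite -!leqNgt.
by case: #|T| => [|[|[|[|[|n]]]]].
Qed.

(** [T] acts faithfully on the cosets of [R], so for index at most 4 its order
    divides 24 and has only the prime divisors 2 and 3. *)
Lemma nonabelian_simple_index (gT : finGroupType) (T R : {group gT}) :
  nonabelian_simple T -> R \proper T -> 4 < #|T : R|.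
Proof.
move=> simT ltRT; have := nonabelian_simple_primes simT.
apply: contraTT; rewrite -!leqNgt => le4.
have [/simpleP[_ simTP] _] := andP simT; have sRT := proper_sub ltRT.
pose S := rcosets R T; have nST : actby_cond T S 'Rs := actsRs_rcosets R T.
have ffulT : [faithful T, on S | 'Rs].
  rewrite /faithful astabRs_rcosets; have /andP[sKR nKT] := gcore_normal sRT.
  have [-> | KT] := simTP _ (gcore_normal sRT); first by rewrite subsetIr.
  by have := proper_subn ltRT; rewrite -{1}KT gcore_sub.
have dvT : #|T| %| (#|T : R|)`!.
  have /isomP[injT _] := faithful_isom nST ffulT.
  rewrite -(card_injm injT) // -[#|T : R|]/(#|S|) -(perm.card_Sym S); apply: cardSg.
  apply/subsetP => _ /morphimP[a _ Ta ->]; rewrite inE; apply/subsetP => x.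
  rewrite inE; apply: contraR => Sx.
  by rewrite actpermE /= /actby (negPf Sx).
have fact24 : (#|T : R|)`! %| 24 by case: #|T : R| le4 => [|[|[|[|[|]]]]].
have : {subset primes #|T| <= primes 24}.
  move=> p; rewrite !mem_primes => /and3P[-> _ pT] /=.
  exact: dvdn_trans pT (dvdn_trans dvT fact24).
by apply: uniq_leq_size; apply: primes_uniq.
Qed.

(** Otherwise [R] would be a Frobenius complement, and the Frobenius kernel would
    be a proper nontrivial normal subgroup. *)
Lemma simple_not_TI (gT : finGroupType) (T R : {group gT}) :
  simple T -> R \proper T -> R :!=: 1 ->
  exists2 x, x \in T :\: R & R :&: R :^ x != 1.
Proof.
case/simpleP=> _ simTP ltRT ntR; apply/exists_inP; apply: contraT.
rewrite negb_exists_in => /forall_inP tiR; have [sRT nsTR] := andP ltRT.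
have frobT : [Frobenius T with complement R].
  rewrite /Frobenius_group_with_complement (proper_neq ltRT).
  apply/normedTI_P; split; first by rewrite setD_eq0 subG1.
    by rewrite subsetI sRT normD1 normG.
  move=> g Tg; apply: contraR => nRg; rewrite -setI_eq0.
  have := tiR g; rewrite inE nRg Tg negbK => /(_ isT)/eqP tiRg.
  by rewrite conjD1g -setDIl tiRg setDv.
have [K /andP[/eqP defT _]] := Frobenius_kernel_exists frobT.
have [nsKT _ KR _ tiKR] := sdprod_context defT.
have [K1 | KT] := simTP K nsKT.
  by case/eqP: (proper_neq ltRT); rewrite -KR K1 mul1g.
by case/eqP: ntR; rewrite -tiKR KT (setIidPr sRT).
Qed.

Lemma isog_nonabelian_simple (aT gT : finGroupType) (T : {group aT})
    (S : {group gT}) :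
  nonabelian_simple T -> T \isog S -> nonabelian_simple S.
Proof.
move=> /andP[simT nabT] iTS.
by rewrite /nonabelian_simple -(isog_simple iTS) -(isog_abelian iTS) simT.
Qed.

Lemma simple_nonabelian_TI (gT : finGroupType) (S : {group gT}) :
  simple S -> ~~ abelian S -> S :&: 'C(S) = 1.
Proof.
move=> /simpleP[_ simS] nabS.
have [//|ZS] := simS _ (center_normal S).
by rewrite /abelian -{1}ZS subsetIr in nabS.
Qed.

Lemma normal_TI_commute (gT : finGroupType) (N L1 L2 : {group gT}) :
  L1 <| N -> L2 <| N -> L1 :&: L2 = 1 -> L2 \subset 'C(L1).
Proof.
move=> /andP[sL1 nL1] /andP[sL2 nL2] tiL.
rewrite centsC; apply/commG1P/trivgP; rewrite -tiL commg_subI // subsetI subxx /=.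
  exact: subset_trans nL2.
exact: subset_trans nL1.
Qed.

Lemma simple_normals_commute (gT : finGroupType) (N L1 L2 : {group gT}) :
  simple L1 -> simple L2 -> L1 <| N -> L2 <| N -> L1 :!=: L2 ->
  L2 \subset 'C(L1).
Proof.
move=> /simpleP[ntL1 simL1] /simpleP[_ simL2] nsL1 nsL2 neqL.
have [sL1 sL2] := (normal_sub nsL1, normal_sub nsL2).
have nsI := normalS (subsetIl L1 L2) sL1 (normalI nsL1 nsL2).
have [tiL | defL1] := simL1 (L1 :&: L2)%G nsI.
  exact: normal_TI_commute nsL1 nsL2 tiL.
have sL12 : L1 \subset L2 by rewrite -defL1 subsetIr.
case/eqP: neqL; have [L1T | //] := simL2 L1 (normalS sL12 sL2 nsL1).
by case/eqP: ntL1.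
Qed.

(** [L] has trivial centre, so a direct complement of [L] is its centraliser. *)
Lemma dprod_simple_cent (gT : finGroupType) (L K N : {group gT}) :
  nonabelian_simple L -> L \x K = N -> L \x 'C_N(L) = N.
Proof.
case/andP=> simL nabL /dprodP[_ LK cLK _].
have sLN : L \subset N by rewrite -LK mulG_subl.
rewrite dprodE ?subsetIr //; last first.
  by apply/trivgP; rewrite -(simple_nonabelian_TI simL nabL) setIS // subsetIr.
apply/eqP; rewrite eqEsubset mul_subG ?subsetIl //= -{1}LK mulgS //.
by rewrite subsetI cLK -LK mulG_subr.
Qed.

(** * Direct powers and direct products *)

Lemma direct_power_factors (gT aT : finGroupType) (N : {group gT})
    (T : {group aT}) (m : nat) :
  N \isog direct_power T m ->
  exists S : 'I_m -> {group gT},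
    \big[dprod/1]_i S i = N /\ forall i, T \isog S i.
Proof.
rewrite isog_sym => /isogP[f injf fT].
exists (fun i => (f @* set1gXn (i := i) T)%G); split=> [|i].
  by rewrite -fT -(injm_bigdprod _ injf (setXn_dprod (fun i : 'I_m => T))).
apply: isog_trans (isog_setXn T) (sub_isog _ injf).
rewrite /= set1gXnE; apply/subsetP => x /setXnP xT; apply/setXnP => j.
by have := xT j; case: dfwithP => // k _ /set1P ->.
Qed.

Lemma card_direct_power (gT aT : finGroupType) (A : {group gT})
    (T : {group aT}) (m : nat) :
  A \isog direct_power T m -> #|A| = (#|T| ^ m)%N.
Proof.
by move/card_isog ->; rewrite cardsXn prod_nat_const card_ord.
Qed.

Lemma bigdprod_factor (gT : finGroupType) (I : finType) (S : I -> {group gT})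
    (N : {group gT}) (i : I) :
  \big[dprod/1]_j S j = N -> exists K : {group gT}, S i \x K = N.
Proof.
rewrite (bigD1 i) //= => defN.
by have [[_ K _ defK] _ _ _] := dprodP defN; exists K; rewrite -defK.
Qed.

(** The images in [A / K] of the direct factors of [A] are normal and generate
    [A / K], so one of them is all of it. *)
Lemma simple_quotient_direct_power (gT aT : finGroupType) (A K : {group gT})
    (R : {group aT}) (m : nat) :
  A \isog direct_power R m -> A \subset 'N(K) -> simple (A / K) ->
  #|A / K| <= #|R|.
Proof.
case/direct_power_factors=> S [defA isoS] nKA /simpleP[ntAK simAK].
have [/forallP sSK | ] := boolP [forall i, S i \subset K].
  case/eqP: ntAK; apply/trivgP; rewrite quotient_sub1 //.
  by rewrite -(bigdprodWY defA) gen_subG; apply/bigcupsP => i _.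
rewrite negb_forall => /existsP[i nSK].
have [K' /dprod_normal2[nsSA _]] := bigdprod_factor i defA.
rewrite (card_isog (isoS i)).
have [SK1 | <-] := simAK _ (quotient_normal K nsSA); last exact: leq_quotient.
case/negP: nSK; rewrite -quotient_sub1 ?SK1 //.
exact: subset_trans (normal_sub nsSA) nKA.
Qed.

(** Modulo ['C(S1)] every factor of the product except [f S1] disappears. *)
Lemma prod_cent_component (gT : finGroupType) (A : {set {group gT}})
    (f : {group gT} -> gT) (S1 : {group gT}) :
  S1 \in A -> (forall S, S \in A -> f S \in S) ->
  (forall S, S \in A -> S != S1 -> S \subset 'C(S1)) ->
  \prod_(S in A) f S \in 'C(S1) -> f S1 \in 'C(S1).
Proof.
move=> AS1 Af cA cprod.
have nf S : S \in A -> f S \in 'N('C(S1)).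
  move=> AS; have [-> | neqS] := eqVneq S S1.
    by rewrite (subsetP _ _ (Af _ AS1)) // norms_cent ?normG.
  by rewrite (subsetP (normG _)) // (subsetP (cA S AS neqS)) ?Af.
apply: coset_idr; first exact: nf.
have := morph_prod (coset_morphism 'C(S1)) (index_enum _) nf.
rewrite /= coset_id // => ->.
rewrite (big_only1 S1) // => S neqS AS.
by rewrite /= coset_id // (subsetP (cA S AS neqS)) ?Af.
Qed.

Lemma simple_factorP (gT : finGroupType) (N S : {group gT}) :
  S \in simple_factors N -> simple S /\ S <| N.
Proof.
by rewrite inE => /andP[simS /existsP[K /eqP/dprod_normal2[nsSN _]]].
Qed.

(** * Producing many fixed points *)

Section FixedPoints.
Variables (P : finType).
Implicit Types (L K : {group {perm P}}) (x d g : {perm P}) (alpha : P).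

Lemma orbit_sub_fix K alpha d :
  'P%act alpha d = alpha -> K \subset 'C[d] ->
  orbit 'P K alpha \subset 'Fix_'P[d].
Proof.
move=> fixd cKd; apply/subsetP => _ /imsetP[k Kk ->]; apply/afix1P.
by rewrite -actM (cent1P (subsetP cKd k Kk)) actM fixd.
Qed.

Lemma card_orbit_setact L alpha g :
  #|orbit 'P (L :^ g) ('P%act alpha g)| = #|orbit 'P L alpha|.
Proof. by rewrite -setact_orbit card_setact. Qed.

(** [K] commutes with [d], so the [K]-orbits of [alpha] and of its image under
    [x] are fixed pointwise by [d]; [L] permutes the [K]-orbits meeting the
    [L]-orbit of [alpha], so these all have the same length, and their number
    is at most that length because [K] contains a copy of [L] whose orbit
    through [alpha] is as long. *)
Lemma many_fixed_points L K alpha d x g :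
  [transitive L <*> K, on [set: P] | 'P] -> K \subset 'C(L) ->
  'P%act alpha g = alpha -> L :^ g \subset K ->
  d \in L -> 'P%act alpha d = alpha ->
  x \in L -> 'P%act ('P%act alpha x) d = 'P%act alpha x ->
  'P%act alpha x \notin orbit 'P K alpha ->
  4 * #|P| <= #|'Fix_'P[d]| ^ 2.
Proof.
move=> trLK cLK fixg sLgK Ld fixd Lx fixxd nKx.
have oKL l : l \in L -> #|orbit 'P K ('P%act alpha l)| = #|orbit 'P K alpha|.
  move=> Ll; rewrite -(card_orbit_setact K alpha l) (normsP _ l Ll) //.
  by rewrite cents_norm // centsC.
have leLK : #|orbit 'P L alpha| <= #|orbit 'P K alpha|.
  rewrite -(card_orbit_setact L alpha g) fixg subset_leq_card //.
  exact: imsetS.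
have cKd : K \subset 'C[d] by rewrite sub_cent1 (subsetP _ d Ld) // centsC.
have le_fix : 2 * #|orbit 'P K alpha| <= #|'Fix_'P[d]|.
  rewrite mul2n -addnn -{2}(oKL x Lx) -cardsUI.
  rewrite (_ : orbit 'P K alpha :&: _ = set0) ?cards0 ?addn0; last first.
    apply/eqP; rewrite setI_eq0 disjoints_subset; apply/subsetP => y Ky.
    rewrite inE; apply: contra nKx => xKy.
    by rewrite -(orbit_transl _ xKy) // orbit_sym.
  by apply: subset_leq_card; rewrite subUset !orbit_sub_fix.
have le_P : #|P| <= #|orbit 'P K alpha| * #|orbit 'P K alpha|.
  apply: leq_trans (leq_mul leLK (leqnn _)).
  rewrite -cardsT -(atransP trLK alpha (in_setT _)) -sum_nat_const.
  have sub : orbit 'P (L <*> K) alpha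
      \subset \bigcup_(b in orbit 'P L alpha) orbit 'P K b.
    apply/subsetP => _ /imsetP[lk LKlk ->].
    have /mulsgP[l k Ll Kk ->] : lk \in L * K by rewrite -cent_joinEr.
    by apply/bigcupP; exists ('P%act alpha l); rewrite ?actM ?mem_orbit.
  apply: leq_trans (subset_leq_card sub) _.
  apply: (@leq_trans (\sum_(b in orbit 'P L alpha) #|orbit 'P K b|)).
    elim/big_ind2: _ => [|a A b B leA leB|//]; first by rewrite cards0.
    by apply: leq_trans (leq_card_setU A B) (leq_add leA leB).
  by apply: leq_sum => _ /imsetP[l Ll ->]; rewrite oKL.
by move: le_fix le_P; nia.
Qed.

End FixedPoints.

(** * Minimal normal subgroups of primitive groups *)

Section MinimalNormal.
Variables (P : finType) (G N : {group {perm P}}) (alpha : P).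
Hypotheses (primG : [primitive G, on [set: P] | 'P]).
Hypotheses (minN : N \in minimal_normals G).

Lemma minimal_normal_normal : N <| G.
Proof.
by move: minN; rewrite inE /normal => /andP[/mingroupp/andP[_ ->] ->].
Qed.

Lemma minimal_normal_ntrivial : N :!=: 1.
Proof. by move: minN; rewrite inE => /andP[/mingroupp/andP[]]. Qed.

Lemma minimal_normal_min (H : {group {perm P}}) :
  H :!=: 1 -> G \subset 'N(H) -> H \subset N -> H :=: N.
Proof.
move=> ntH nHG; move: minN; rewrite inE => /andP[/mingroupP[_ minHN] _].
by apply: minHN; rewrite ntH.
Qed.

Lemma minimal_normal_trans : [transitive N, on [set: P] | 'P].
Proof.
have [cNP|//] := prim_trans_norm primG minimal_normal_normal.
case/negP: minimal_normal_ntrivial; apply/eqP/trivgP.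
apply: subset_trans cNP _; apply: subset_trans (subsetIr _ _) _.
by have := aperm_faithful [set: {perm P}]%G; rewrite /faithful setTI.
Qed.

Lemma minimal_normal_prod : 'C_G[alpha | 'P] * N = G.
Proof.
have [trG _] := andP primG.
have /andP[sNG _] := minimal_normal_normal.
exact/(subgroup_transitiveP (in_setT alpha) sNG trG)/minimal_normal_trans.
Qed.

Lemma minimal_normal_norm (H : {group {perm P}}) :
  H \subset N -> N \subset 'N(H) -> 'C_G[alpha | 'P] \subset 'N(H) ->
  H :=: 1 \/ H :=: N.
Proof.
move=> sHN nHN nHGa; have [->|ntH] := eqVneq (H : {set _}) 1; first by left.
right; apply: minimal_normal_min => //.
by rewrite -minimal_normal_prod mul_subG.
Qed.

(** [G_alpha] is maximal in [G]; if it did not contain [M], then [M * G_alpha = G]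
    and the modular law would give [M = N]. *)
Lemma stabilizer_maximal (M : {group {perm P}}) :
  M \proper N -> 'C_G[alpha | 'P] \subset 'N(M) -> 'C_N[alpha | 'P] \subset M ->
  M :=: 'C_N[alpha | 'P].
Proof.
move=> ltMN nMGa sNaM; have sMN := proper_sub ltMN.
have [trG _] := andP primG; have /andP[sNG nNG] := minimal_normal_normal.
have /maximal_eqP[_ maxGa] : maximal_eq 'C_G[alpha | 'P] G.
  by rewrite -(trans_prim_astab (in_setT alpha) trG).
have [|||MGa] := maxGa (M <*> 'C_G[alpha | 'P])%G.
- exact: joing_subr.
- by rewrite join_subG subsetIl (subset_trans sMN sNG).
- rewrite /= => MGa; apply/eqP; rewrite eqEsubset sNaM andbT subsetI sMN.
  by apply: subset_trans (joing_subl M 'C_G[alpha | 'P]) _; rewrite MGa subsetIr.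
case/negP: (proper_subn ltMN).
rewrite -{1}(setIidPr sNG) -MGa /= norm_joinEr // -group_modl //.
by rewrite mul_subG // setIAC (setIidPr sNG).
Qed.

(** Otherwise [L] would be normalised by [N * G_alpha = G]. *)
Lemma minimal_normal_moves (L : {group {perm P}}) :
  L <| N -> L :!=: 1 -> L :!=: N ->
  exists2 g, g \in 'C_G[alpha | 'P] & L :^ g != L.
Proof.
move=> /andP[sLN nLN] ntL neqLN; apply/exists_inP; apply: contraT.
rewrite negb_exists_in => /forall_inP nLGa.
case: (minimal_normal_norm sLN nLN) => [|/eqP|/eqP].
- by apply/normsP => g Ga; apply/eqP; rewrite -[_ == _]negbK nLGa.
- by rewrite (negPf ntL).
- by rewrite (negPf neqLN).
Qed.

Lemma card_points : (#|P| * #|'C_N[alpha | 'P]| = #|N|)%N.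
Proof.
rewrite -cardsT -(atransP minimal_normal_trans alpha (in_setT _)).
by rewrite card_orbit mulnC Lagrange // subsetIl.
Qed.

Lemma stabilizer_norm : 'C_G[alpha | 'P] \subset 'N('C_N[alpha | 'P]).
Proof.
have /andP[sNG nNG] := minimal_normal_normal.
have nNGa := subset_trans (subsetIl G 'C[alpha | 'P]) nNG.
by rewrite -(setIidPl sNG) -setIA; apply: normsI nNGa _; rewrite normG.
Qed.

(** The intersection of the [G_alpha]-conjugates of [H] is normalised by
    [G_alpha], which makes [stabilizer_maximal] applicable. *)
Lemma stabilizer_core (H : {group {perm P}}) :
  H \proper N -> 'C_N[alpha | 'P] \subset H ->
  \bigcap_(g in 'C_G[alpha | 'P]) H :^ g = 'C_N[alpha | 'P].
Proof.
move=> ltHN sAH.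
have sMH : \bigcap_(g in 'C_G[alpha | 'P]) H :^ g \subset H.
  by apply/subsetP => y /bigcapP/(_ 1 (group1 _)); rewrite conjsg1.
apply: stabilizer_maximal (sub_proper_trans sMH ltHN) _ _.
  apply/normsP => h Gah; apply/eqP; rewrite eqEcard cardJg leqnn andbT.
  apply/bigcapsP => g Gag; rewrite sub_conjg -conjsgM; apply/subsetP => y.
  by move/bigcapP/(_ _ (groupM Gag (groupVr Gah))).
by apply/bigcapsP => g Gag; rewrite -(normsP stabilizer_norm g Gag) conjSg.
Qed.

(** Let [A = N_alpha] and let [AK] be the preimage in [N] of the projection of
    [A] to [L].  By [stabilizer_core], [A] is the intersection of the conjugates
    of [AK] under [G_alpha]; such a conjugate either contains the same [K] or
    contains [L], because distinct simple normal subgroups commute.  So the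
    part of [AK] in [L] lies in all of them. *)
Lemma stabilizer_splits (L : {group {perm P}}) :
  simple L -> L <| N ->
  'C_N[alpha | 'P] * 'C_N(L) != N ->
  L :&: 'C_N[alpha | 'P] * 'C_N(L) \subset 'C_N[alpha | 'P].
Proof.
move=> simL nsLN neqAK; have [sLN nLN] := andP nsLN.
have /andP[sNG nNG] := minimal_normal_normal.
set A := 'C_N[alpha | 'P] in neqAK *; set K := 'C_N(L) in neqAK *.
have sAN : A \subset N by apply: subsetIl.
have nKN : N \subset 'N(K) by rewrite normsI ?normG ?norms_cent.
have defAK : A <*> K = A * K by rewrite norm_joinEl // (subset_trans sAN).
have ltAKN : A <*> K \proper N.
  by rewrite properEneq defAK neqAK -defAK join_subG sAN subsetIl.
have defA : \bigcap_(g in 'C_G[alpha | 'P]) (A <*> K) :^ g = A :=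
  stabilizer_core ltAKN (joing_subl A K).
apply/subsetP => y /setIP[Ly AKy]; rewrite -defA; apply/bigcapP => g Gag.
have nNg : N :^ g = N by apply: (normsP nNG); case/setIP: Gag.
have KgE : K :^ g = 'C_N(L :^ g) by rewrite conjIg nNg -centJ.
have [Lg | neqLg] := eqVneq (L :^ g) L.
  have sAg : A \subset (A <*> K) :^ g.
    by apply/subsetP => z; rewrite -{1}defA => /bigcapP/(_ g Gag).
  have sKg : K \subset (A <*> K) :^ g.
    by rewrite conjYg sub_gen // subsetU // KgE Lg subxx orbT.
  by apply: subsetP AKy; rewrite -defAK join_subG sAg.
apply: subsetP (y) Ly; rewrite conjYg sub_gen // subsetU //; apply/orP; right.
rewrite KgE subsetI sLN.
apply: (@simple_normals_commute _ N (L :^ g)) => //.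
- by rewrite -(isog_simple (conj_isog L g)).
- by rewrite -nNg normalJ.
Qed.

(** If [A = N_alpha] met [L] trivially, [stabilizer_splits] would put it inside
    ['C_N(L)]; then it is the intersection of the [G_alpha]-conjugates of
    ['C_N(L)], which are normal in [N], and so [A] is normal in [G]. *)
Lemma stabilizer_meets (L : {group {perm P}}) :
  simple L -> ~~ abelian L -> L \x 'C_N(L) = N ->
  'C_N[alpha | 'P] * 'C_N(L) != N -> 'C_N[alpha | 'P] != 1 ->
  L :&: 'C_N[alpha | 'P] != 1.
Proof.
move=> simL nabL defN neqAK; apply: contra => /eqP tiLA.
have [_ LK _ _] := dprodP defN.
have /andP[sNG nNG] := minimal_normal_normal.
have [nsLN _] := dprod_normal2 defN; have [sLN nLN] := andP nsLN.
have sLA := stabilizer_splits simL nsLN neqAK.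
set A := 'C_N[alpha | 'P] in tiLA neqAK sLA *.
set K := 'C_N(L) in LK neqAK sLA defN *.
have sAN : A \subset N by apply: subsetIl.
have nKN : N \subset 'N(K) by rewrite normsI ?normG ?norms_cent.
have sAK : A \subset K.
  apply/subsetP => a Aa; have : a \in L * K by rewrite LK (subsetP sAN).
  case/mulsgP=> l x Ll Kx defa; suff l1 : l = 1 by rewrite defa l1 mul1g.
  apply/set1P; rewrite -set1gE -tiLA inE Ll (subsetP sLA) // inE Ll.
  by rewrite -(mulgK x l) -defa mem_mulg ?groupV.
have ltKN : K \proper N.
  rewrite properE subsetIl; apply: contra nabL => sNK.
  by apply: subset_trans sLN (subset_trans sNK (subsetIr _ _)).
have defA : \bigcap_(g in 'C_G[alpha | 'P]) K :^ g = A :=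
  stabilizer_core ltKN sAK.
have nAN : N \subset 'N(A).
  rewrite -defA norms_bigcap //; apply/bigcapsP => g /setIP[Gg _].
  by rewrite -(normsP nNG g Gg) normJ conjSg.
have nAGa : 'C_G[alpha | 'P] \subset 'N(A) := stabilizer_norm.
have [A1|AN] : A = 1 \/ A = N := minimal_normal_norm sAN nAN nAGa.
  exact/eqP.
by case/eqP: neqAK; rewrite AN mulGSid // subsetIl.
Qed.

Lemma not_in_orbit (K : {group {perm P}}) x :
  K \subset N -> x \in N -> x \notin 'C_N[alpha | 'P] * K ->
  'P%act alpha x \notin orbit 'P K alpha.
Proof.
move=> sKN Nx; apply: contra => /imsetP[y Ky xy].
have Axy : x * y^-1 \in 'C_N[alpha | 'P].
  rewrite inE groupM ?groupV ?(subsetP sKN y) //=.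
  by apply/astab1P; rewrite actM xy actK.
by apply/mulsgP; exists (x * y^-1) y; rewrite ?mulgKV.
Qed.

End MinimalNormal.

(** * The three types *)

Section Types.
Variables (P : finType) (B : {set {set P}}) (v k : nat).
Variables (G : {group {perm P}}) (alpha : P).
Hypotheses (biB : biplane B v k) (k_ge4 : 4 <= k) (autG : G \subset autD B).
Hypothesis primG : [primitive G, on [set: P] | 'P].

Lemma few_fixed_points (d : {perm P}) :
  16 < #|P| -> d \in G -> d != 1 -> #|'Fix_'P[d]| ^ 2 < 4 * #|P|.
Proof.
have [oP _ _ _] := biB; rewrite oP => v_gt16 Gd.
by apply: biplane_fix_bound biB (biplane_k_gt6 biB k_ge4 v_gt16) (subsetP autG d Gd).
Qed.

Lemma not_type_HC : ~ type_HC G.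
Proof.
case=> aT [T [m [N1 [N2 [simT m_gt1 neqN defmin isoN]]]]].
have min1 : N1 \in minimal_normals G by rewrite defmin !inE eqxx.
have min2 : N2 \in minimal_normals G by rewrite defmin !inE eqxx orbT.
have /andP[sN1G nN1G] := minimal_normal_normal min1.
have /andP[sN2G nN2G] := minimal_normal_normal min2.
have [isoN1 [trN1 reg1]] := isoN _ min1; have [_ [trN2 _]] := isoN _ min2.
have ti12 : N1 :&: N2 = 1.
  apply/eqP; apply: contraNT neqN => ntI; rewrite -val_eqE /=.
  have nIG : G \subset 'N(N1 :&: N2) by rewrite normsI.
  rewrite -(minimal_normal_min min1 ntI nIG (subsetIl _ _)).
  by rewrite {1}(minimal_normal_min min2 ntI nIG (subsetIr _ _)).
have c12 : N2 \subset 'C(N1).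
  exact: normal_TI_commute (minimal_normal_normal min1)
           (minimal_normal_normal min2) ti12.
have [S [defN1 isoS]] := direct_power_factors isoN1.
pose i := Ordinal (ltnW m_gt1).
have [K defK] := bigdprod_factor i defN1.
have [_ SK cSK tiSK] := dprodP defK.
have oS : #|S i| = #|T| by rewrite (card_isog (isoS i)).
have oN1 : #|N1| = (#|T| ^ m)%N := card_direct_power isoN1.
have oP : #|P| = #|N1|.
  by rewrite -(card_points alpha primG min1) reg1 cards1 muln1.
have T_gt4 := nonabelian_simple_card simT.
have oSK : #|N1| = (#|T| * #|K|)%N by rewrite -(dprod_card defK) oS.
have leTK : #|T| <= #|K|.
  rewrite -(@leq_pmul2l #|T|) ?cardG_gt0 // -oSK oN1 mulnn.
  by rewrite leq_pexp2l // cardG_gt0.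
have [t St nt_t] : exists2 t, t \in S i & t != 1.
  have /trivgPn[t] : S i :!=: 1 by rewrite -cardG_gt1 oS; apply: leq_trans T_gt4.
  by exists t.
have N1t : t \in N1 by rewrite -SK; apply: (subsetP (mulG_subl _ _)).
have [n N2n fixn] : exists2 n, n \in N2 & 'P%act alpha n = 'P%act alpha t^-1.
  have [n N2n] := atransP2 trN2 (in_setT alpha) (in_setT ('P%act alpha t^-1)).
  by exists n.
(* Identify [P] with [N1] by regularity, [alpha] with [1]: [n * t] acts as
   conjugation by [t]. *)
pose d := n * t.
have Gd : d \in G by rewrite groupM ?(subsetP sN2G n) ?(subsetP sN1G t).
have fixd : 'P%act alpha d = alpha by rewrite actM fixn actKV.
have nt_d : d != 1.
  apply: contra nt_t; rewrite -eq_invg_mul => /eqP nt.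
  by rewrite -in_set1 -set1gE -ti12 inE N1t -nt groupV.
have sub_fix : orbit 'P 'C_N1[t] alpha \subset 'Fix_'P[d].
  apply: orbit_sub_fix fixd _; apply/subsetP => c /setIP[N1c /cent1P ct].
  apply/cent1P; apply: commuteM => //; apply/commute_sym.
  exact: (centsP c12 n N2n c N1c).
have le_orbit : 2 * #|K| <= #|orbit 'P 'C_N1[t] alpha|.
  rewrite card_orbit setIAC reg1 (setIidPl (sub1G _)) indexg1.
  have tiTK : <[t]> :&: K = 1.
    by apply/trivgP; rewrite -tiSK setSI // cycle_subG.
  apply: (@leq_trans #|<[t]> * K|).
    by rewrite (TI_cardMg tiTK) leq_pmul2r ?cardG_gt0 // order_gt1.
  rewrite subset_leq_card // subsetI -{1}SK mulSg ?cycle_subG //=.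
  by rewrite mul_subG ?cycle_subG ?cent1id // sub_cent1 (subsetP _ t St) // centsC.
have P_gt16 : 16 < #|P|.
  by rewrite oP oSK; apply: leq_trans (leq_mul T_gt4 (leq_trans T_gt4 leTK)).
have := few_fixed_points P_gt16 Gd nt_d; rewrite ltnNge => /negP; apply.
apply: (@leq_trans ((2 * #|K|) ^ 2)).
  rewrite oP oSK expnMn leq_pmul2l // -mulnn leq_pmul2r ?cardG_gt0 //.
by rewrite leq_sqr; apply: leq_trans le_orbit (subset_leq_card sub_fix).
Qed.

Lemma not_type_PA : ~ type_PA G alpha.
Proof.
case=> aT [T [m [N [simT m_gt1 defmin isoN [R [ltRT ntR isoA]]]]]].
have minN : N \in minimal_normals G by rewrite defmin inE.
have /andP[sNG nNG] := minimal_normal_normal minN.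
have [S [defNS isoS]] := direct_power_factors isoN.
pose i := Ordinal (ltnW m_gt1); set L := S i.
have nsimL : nonabelian_simple L := isog_nonabelian_simple simT (isoS i).
have [simL nabL] := andP nsimL.
have [K0 defK0] := bigdprod_factor i defNS.
have defN := dprod_simple_cent nsimL defK0.
have [[nsLN nsKN] [_ LK cLK tiLK]] := (dprod_normal2 defN, dprodP defN).
have [[sLN nLN] [sKN nKN]] := (andP nsLN, andP nsKN).
have oL : #|L| = #|T| by rewrite (card_isog (isoS i)).
have oN : #|N| = (#|T| ^ m)%N := card_direct_power isoN.
have oA : #|'C_N[alpha | 'P]| = (#|R| ^ m)%N := card_direct_power isoA.
have sAN : 'C_N[alpha | 'P] \subset N := subsetIl _ _.
have P_gt16 : 16 < #|P|.
  have c_gt4 := nonabelian_simple_index simT ltRT.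
  have : (#|P| * #|R| ^ m)%N = (#|R| ^ m * #|T : R| ^ m)%N.
    rewrite -expnMn Lagrange ?proper_sub // -oN -oA.
    exact: card_points primG minN.
  rewrite mulnC => /eqP; rewrite eqn_pmul2l ?expn_gt0 ?cardG_gt0 // => /eqP ->.
  apply: leq_trans (leq_pexp2l _ m_gt1); rewrite ?(leq_trans _ c_gt4) // -mulnn.
  exact: leq_trans (leq_mul c_gt4 c_gt4).
(* [N_alpha] is too small to project onto [L]. *)
have neqAK : 'C_N[alpha | 'P] * 'C_N(L) != N.
  apply/eqP => AK; have nKA := subset_trans sAN nKN.
  have AL : 'C_N[alpha | 'P] / 'C_N(L) = L / 'C_N(L).
    by rewrite -quotientMidr (etrans AK (esym LK)) quotientMidr.
  have isoL : L \isog L / 'C_N(L).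
    by apply: quotient_isog; [apply: subset_trans sLN nKN | rewrite setIC].
  have := simple_quotient_direct_power isoA nKA; rewrite /= AL -(isog_simple isoL).
  by move=> /(_ simL); rewrite -(card_isog isoL) oL leqNgt proper_card.
have ntA : 'C_N[alpha | 'P] != 1.
  rewrite -cardG_gt1 oA (leq_trans _ (leq_pexp2l _ (ltnW m_gt1))) ?cardG_gt0 //.
  by rewrite expn1 cardG_gt1.
have sLA := stabilizer_splits primG minN simL nsLN neqAK.
have ntLA := stabilizer_meets primG minN simL nabL defN neqAK ntA.
have ltLA : L :&: 'C_N[alpha | 'P] \proper L.
  rewrite properE subsetIl; apply: contra neqAK; rewrite subsetI => /andP[_ sLA'].
  by rewrite eqEsubset mul_subG //= -{1}LK mulSg.
have [x] := @simple_not_TI _ L (L :&: 'C_N[alpha | 'P])%G simL ltLA ntLA.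
case/setDP=> Lx nAx /trivgPn[d /setIP[LAd LAxd] nt_d].
have [Ld Ad] := setIP LAd; have [Nd fixd] := setIP Ad.
have Nx := subsetP sLN x Lx.
have [] := minimal_normal_moves alpha primG minN nsLN.
- by case/simpleP: simL.
- apply/eqP => LN; have := oN; rewrite -LN oL -{1}[#|T|]expn1 => /eqP.
  rewrite eqn_exp2l; first by rewrite ltn_eqF.
  exact: leq_trans (nonabelian_simple_card simT).
move=> g /setIP[Gg fixg] neqLg.
have sLgK : L :^ g \subset 'C_N(L).
  have nNg := normsP nNG g Gg.
  rewrite subsetI -{1}nNg conjSg sLN /=.
  apply: (@simple_normals_commute _ N L (L :^ g)%G) => //.
  - by rewrite -(isog_simple (conj_isog L g)).
  - by rewrite -nNg normalJ.
  - by rewrite eq_sym.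
have := few_fixed_points P_gt16 (subsetP sNG d Nd) nt_d.
rewrite ltnNge => /negP; apply.
apply: (@many_fixed_points _ L 'C_N(L)%G alpha d x g) => //.
- by rewrite /= (dprodWY defN) (minimal_normal_trans primG minN).
- exact/astab1P.
- exact/astab1P.
- move: LAxd; rewrite mem_conjg => /setIP[_ /setIP[_ /astab1P]].
  by rewrite conjgE invgK !actM => /(canRL (actKV _ _)).
apply: (@not_in_orbit _ N) => //=; apply: contra nAx => AKx.
by rewrite inE Lx (subsetP sLA) // inE Lx.
Qed.

Lemma not_type_CD : ~ type_CD G alpha.
Proof.
case=> aT [T [m [l [N [simT defmin isoN /and3P[dvl le2l l_ge2]]]]]].
case=> isoA [Sigma [strip [oSig /and3P[partS actS _] diag defA]]].
have minN : N \in minimal_normals G by rewrite defmin inE.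
have /andP[sNG nNG] := minimal_normal_normal minN.
have /and3P[/eqP covS /trivIsetP tiS _] := partS.
have T_gt4 := nonabelian_simple_card simT.
have l_gt1 : 1 < l by rewrite -(leq_pmul2l (isT : 0 < 2)).
have P_gt16 : 16 < #|P|.
  have oN : #|N| = (#|T| ^ m)%N := card_direct_power isoN.
  have oA : #|'C_N[alpha | 'P]| = (#|T| ^ l)%N := card_direct_power isoA.
  have := card_points alpha primG minN; rewrite oN oA.
  have -> : m = (m - l + l)%N by rewrite subnK // (leq_trans _ le2l) // leq_pmull.
  move/eqP; rewrite expnD eqn_pmul2r ?expn_gt0 ?cardG_gt0 // => /eqP ->.
  have ml_gt1 : 1 < m - l by lia.
  apply: leq_trans (leq_pexp2l _ ml_gt1); rewrite ?cardG_gt0 // -mulnn.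
  exact: leq_trans (leq_mul T_gt4 T_gt4).
have sfS A S : A \in Sigma -> S \in A -> S \in simple_factors N.
  by move=> SA AS; rewrite -covS; apply/bigcupP; exists A.
have nsimS A S : A \in Sigma -> S \in A -> nonabelian_simple S.
  move=> SA AS; have [_ [phi [isoS _]]] := diag A SA.
  exact: isog_nonabelian_simple simT (isom_isog _ (subxx _) (isoS S AS)).
have cS S S' : S \in simple_factors N -> S' \in simple_factors N -> S' != S ->
    S' \subset 'C(S).
  move=> /simple_factorP[simS nsS] /simple_factorP[simS' nsS'].
  by rewrite eq_sym -val_eqE; apply: simple_normals_commute simS simS' nsS nsS'.
have neqS A A' S S' : A \in Sigma -> A' \in Sigma -> A != A' ->
    S \in A -> S' \in A' -> S' != S.
  move=> SA SA' neqA AS AS'; apply: contraTneq (tiS _ _ SA SA' neqA) => eqS.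
  by apply/pred0Pn; exists S; rewrite /= AS -eqS.
have cLS A A' : A \in Sigma -> A' \in Sigma -> A != A' ->
    <<\bigcup_(S in A') gval S>> \subset 'C(<<\bigcup_(S in A) gval S>>).
  move=> SA SA' neqA; rewrite gen_subG; apply/bigcupsP => S' AS'.
  rewrite centsC gen_subG; apply/bigcupsP => S AS.
  rewrite centsC; apply: cS; [exact: sfS SA AS | exact: sfS SA' AS' |].
  exact: neqS neqA AS AS'.
have sSL (A : {set {group {perm P}}}) (S : {group {perm P}}) :
    S \in A -> S \subset <<\bigcup_(S in A) gval S>>.
  by move=> AS; rewrite sub_gen // (bigcup_max S).
have [A0 [A1 [SA0 SA1 neqA01]]] :
    exists A, exists A', [/\ A \in Sigma, A' \in Sigma & A != A'].
  have /card_gt1P[A [A' [? ? ?]]] : 1 < #|Sigma| by rewrite oSig.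
  by exists A, A'.
have q_gt1 : 1 < m %/ l by rewrite leq_divRL ?(ltnW l_gt1).
have [oA0 [phi [isoS defD]]] := diag A0 SA0.
have [S0 [S1 [AS0 AS1 neqS01]]] :
    exists S, exists S', [/\ S \in A0, S' \in A0 & S' != S].
  have /card_gt1P[S' [S [? ? ?]]] : 1 < #|A0| by rewrite oA0.
  by exists S, S'.
have sLN A : A \in Sigma -> <<\bigcup_(S in A) gval S>> \subset N.
  move=> SA; rewrite gen_subG; apply/bigcupsP => S AS.
  by have [_ /normal_sub] := simple_factorP (sfS _ _ SA AS).
have phiS S t : S \in A0 -> t \in T -> phi S t \in S.
  by move=> AS Tt; have /isomP[_ <-] := isoS S AS; apply: mem_morphim.
have stripL A : A \in Sigma -> strip A \subset <<\bigcup_(S in A) gval S>>.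
  move=> SA; have [_ [psi [isopsi ->]]] := diag A SA.
  apply/subsetP => _ /imsetP[t Tt ->]; apply: group_prod => S AS.
  apply: (subsetP (sSL _ _ AS)); have /isomP[_ <-] := isopsi S AS.
  exact: mem_morphim.
pose L := <<\bigcup_(S in A0) gval S>>%G.
have nsLN : L <| N.
  rewrite /normal sLN // norms_gen //; apply: norms_bigcup.
  apply/bigcapsP => S AS.
  by have [_ /normal_norm] := simple_factorP (sfS _ _ SA0 AS).
have nKN : N \subset 'N('C_N(L)).
  by rewrite normsI ?normG ?norms_cent // normal_norm.
have LK : L <*> 'C_N(L) = N.
  apply/eqP; rewrite eqEsubset join_subG sLN // subsetIl /=.
  have [S [defNS isoNS]] := direct_power_factors isoN.
  rewrite -{1}(bigdprodWY defNS) gen_subG; apply/bigcupsP => i _.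
  have sfSi : S i \in simple_factors N.
    rewrite inE -(isog_simple (isoNS i)); have [-> _] := andP simT.
    have [K defK] := bigdprod_factor i defNS.
    by apply/existsP; exists K; rewrite defK.
  have [AS | nAS] := boolP (S i \in A0).
    exact: subset_trans (sSL _ _ AS) (joing_subl _ _).
  apply: subset_trans (joing_subr _ _); rewrite subsetI.
  have [_ /normal_sub-> /=] := simple_factorP sfSi.
  rewrite centsC gen_subG; apply/bigcupsP => S' AS'.
  rewrite centsC; apply: cS sfSi _; first exact: sfS AS'.
  by apply: contraNneq nAS => ->.
(* The strips with support different from [A0] centralise [L]. *)
have sNaDK : 'C_N[alpha | 'P] \subset strip A0 * 'C_N(L).
  have sDN : strip A0 \subset N := subset_trans (stripL _ SA0) (sLN _ SA0).
  rewrite -norm_joinEl ?(subset_trans sDN) //.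
  rewrite -(bigdprodWY defA) gen_subG; apply/bigcupsP => A SA.
  have [-> | neqA] := eqVneq A A0; first exact: joing_subl.
  apply: subset_trans (joing_subr _ _); rewrite subsetI.
  rewrite (subset_trans (stripL _ SA) (sLN _ SA)).
  rewrite (subset_trans (stripL _ SA)) //.
  by apply: cLS; rewrite // eq_sym.
have nsim0 := nsimS _ _ SA0 AS0.
have cA0 S S' : S \in A0 -> S' \in A0 -> S != S' -> S \subset 'C(S').
  by move=> AS AS'; apply: cS; apply: sfS SA0 _.
(* An element of the strip acts on each factor in its support as the
   corresponding coordinate does. *)
have phi_triv S t : S \in A0 -> t \in T ->
    \prod_(S in A0) phi S t \in 'C(S) -> t = 1.
  move=> AS Tt /(prod_cent_component AS) cphi.
  have nsim := nsimS _ _ SA0 AS; have [simS nabS] := andP nsim.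
  have /isomP[injphi _] := isoS S AS.
  apply: (injmP injphi) => //; rewrite morph1; apply/set1P.
  rewrite -set1gE -(simple_nonabelian_TI simS nabS) inE phiS //=.
  by apply: cphi => S' AS' *; [apply: phiS | apply: cA0].
have [t Tt nt_t] : exists2 t, t \in T & t != 1.
  have /trivgPn[t] : T :!=: 1 by rewrite -cardG_gt1; apply: leq_trans T_gt4.
  by exists t.
pose d := \prod_(S in A0) phi S t; pose x := phi S0 t.
have Dd : d \in strip A0 by rewrite defD imset_f.
have nt_d : d != 1.
  by apply: contra nt_t => /eqP d1; apply/eqP/(phi_triv S0) => //; rewrite -/d d1.
have S0x : x \in S0 by apply: phiS.
have Ld : d \in L := subsetP (stripL _ SA0) d Dd.
have Lx : x \in L := subsetP (sSL _ _ AS0) x S0x.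
have Nad : d \in 'C_N[alpha | 'P].
  rewrite -(bigdprodWY defA) mem_gen //; apply/bigcupP; exists A0 => //.
have [Nd fixd] := setIP Nad.
have cxd : commute x d.
  apply/commute_sym/cent1P; apply: group_prod => S AS.
  have [-> | neqS0] := eqVneq S S0; first exact: cent1id.
  apply: (subsetP _ _ (phiS _ _ AS Tt)).
  by rewrite sub_cent1 (subsetP (cA0 _ _ AS0 AS _)) // eq_sym.
have cLS1 S : S \in A0 -> 'C_N(L) \subset 'C(S).
  by move=> AS; rewrite (subset_trans (subsetIr _ _)) // centS // sSL.
have [] := minimal_normal_moves alpha primG minN nsLN.
- by apply/trivgPn; exists d.
- apply/eqP => LN; have [oA1 _] := diag A1 SA1.
  have /card_gt0P[S AS] : 0 < #|A1| by rewrite oA1 ltnW.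
  have [_ /negP[]] := andP (nsimS _ _ SA1 AS); apply: subset_trans (sSL _ _ AS) _.
  apply: subset_trans (sLN _ SA1) _.
  rewrite -LN (subset_trans (cLS _ _ SA1 SA0 _)) 1?eq_sym //.
  by rewrite centS // sSL.
move=> g /setIP[Gg fixg] neqLg.
have sLgK : L :^ g \subset 'C_N(L).
  pose Ag := ('JG^*)%act A0 g.
  have SAg : Ag \in Sigma by rewrite (actsP actS).
  have sLg : L :^ g \subset <<\bigcup_(S in Ag) gval S>>.
    rewrite sub_conjg gen_subG; apply/bigcupsP => S AS.
    by rewrite -sub_conjg (sSL Ag (S :^ g)%G) //; apply: (mem_setact 'JG%act g AS).
  have neqAg : A0 != Ag.
    apply: contraNneq neqLg => AgE; rewrite eqEcard cardJg leqnn andbT.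
    by rewrite {2}/L AgE.
  rewrite subsetI (subset_trans sLg (sLN _ SAg)).
  by rewrite (subset_trans sLg) // cLS.
have := few_fixed_points P_gt16 (subsetP sNG d Nd) nt_d.
rewrite ltnNge => /negP; apply.
apply: (@many_fixed_points _ L 'C_N(L)%G alpha d x g) => //.
- by rewrite /= LK (minimal_normal_trans primG minN).
- exact: subsetIr.
- exact/astab1P.
- exact/astab1P.
- by rewrite -actM cxd actM (astab1P fixd).
apply: (@not_in_orbit _ N) => //=; first exact: subsetIl.
  by apply: (subsetP (sLN _ SA0)).
apply/negP => /(subsetP (mulSg _ sNaDK)).
rewrite -mulgA mulGid defD => /mulsgP[d' y /imsetP[t' Tt' defd'] Ky xE].
(* [x] and [y] centralise [S1], hence so does [d'], although the support of
   its strip contains [S1]. *)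
have t'1 : t' = 1.
  apply: (phi_triv S1) => //; rewrite -defd' -[d'](mulgK y) -xE.
  rewrite groupM ?groupV ?(subsetP (cLS1 _ AS1) y) //.
  by rewrite (subsetP (cA0 _ _ AS0 AS1 _)) // eq_sym.
have xy : x = y by rewrite xE defd' t'1 big1 ?mul1g // => S _; rewrite morph1.
have [sim0 nab0] := andP nsim0; have /isomP[injphi _] := isoS S0 AS0.
case/eqP: nt_t; apply: (injmP injphi) => //; rewrite morph1; apply/set1P.
rewrite -set1gE -(simple_nonabelian_TI sim0 nab0) inE phiS //= -/x xy.
exact: subsetP (cLS1 _ AS0) y Ky.
Qed.

End Types.

Theorem theorem7p4 (P : finType) (B : {set {set P}}) (v k : nat)
    (G : {group {perm P}}) (alpha : P) :
  biplane B v k -> 4 <= k ->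
  G \subset autD B ->
  [primitive G, on [set: P] | 'P] ->
  [/\ ~ type_PA G alpha, ~ type_HC G & ~ type_CD G alpha].
Proof.
move=> biB k_ge4 autG primG; split.
- exact: not_type_PA biB k_ge4 autG primG.
- exact: not_type_HC biB k_ge4 autG primG.
- exact: not_type_CD biB k_ge4 autG primG.
Qed.
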